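(* Let $G$ be a finite connected simple graph and let $\ell \geq k \geq 1$ be integers. Then $$c(G) \leq c_{H,k}(G) \leq c_{H,\ell}(G) \leq c_0(G).$$
   Context: All games considered are played on a finite connected simple graph $G$ by a team of cops (controlled by one player) and one robber, all occupying vertices of $G$. First the cops choose their starting vertices (several cops may share a vertex), then the robber chooses his starting vertex. Then the players alternate turns, cops first: on the cops' turn each cop stays or moves to an adjacent vertex; on the robber's turn he stays or moves to an adjacent vertex. The robber always sees the positions of all cops. The cops win if after finitely many rounds some cop occupies the same vertex as the robber; otherwise the robber wins. In the usual game the cops always see the robber; $c(G)$ (the cop number) is the minimum number of cops that have a winning strategy. In the $k$-hyperopic game ($k\ge 1$ an integer) the robber is invisible to the cops whenever every cop satisfies $1 \le d(r,c) \le k$, where $r$ and $c$ are the current positions of the robber and that cop; otherwise his position is known to all cops; $c_{H,k}(G)$ is the minimum number of cops that have a winning strategy. In the 0-visibility game the robber is invisible unless some cop is on the same vertex as him; $c_0(G)$ is the minimum number of cops that have a winning strategy. In the $k$-hyperopic and 0-visibility games the robber is omniscient: he knows the complete strategy of the cops in advance, so he is never captured by chance, i.e. a winning cop strategy must guarantee capture against every possible play of the robber. *)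

(* Defs.v *)
From mathcomp Require Import all_boot.
From mathcomp Require Import boolp.

Set Implicit Arguments.
Unset Strict Implicit.
Unset Printing Implicit Defensive.

(* A graph is an adjacency relation on a finite type of vertices; the empty
   graph is not considered connected. *)
Definition simple_graph (V : finType) (e : rel V) : Prop :=
  symmetric e /\ irreflexive e.

Definition connected_graph (V : finType) (e : rel V) : Prop :=
  0 < #|V| /\ forall x y : V, connect e x y.

Definition has_walk (V : finType) (e : rel V) (x y : V) (d : nat) : bool :=
  [exists p : d.-tuple V, path e x p && (last x p == y)].

(* The least length of a walk from x to y. Shortest paths have fewer than #|V|
   edges, so searching below #|V| suffices; the value is #|V| exactly when x
   and y are not connected. *)
Definition dist (V : finType) (e : rel V) (x y : V) : nat :=
  find (has_walk e x y) (iota 0 #|V|).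

Section Game.

Variables (V : finType) (e : rel V).

Definition step (x y : V) : bool := (x == y) || e x y.

Definition cops (n : nat) : Type := {ffun 'I_n -> V}.

(* A game variant is given by a visibility rule: whether the robber, standing
   at the given vertex, is seen by cops standing at the given positions. *)
Definition visibility : Type := forall n : nat, cops n -> V -> bool.

Definition always_visible : visibility := fun n C r => true.

Definition hyperopic_visible (k : nat) : visibility :=
  fun n C r => ~~ [forall i, 1 <= dist e r (C i) <= k].

Definition zero_visible : visibility := fun n C r => [exists i, C i == r].

(* What the cops know of a configuration: their own positions, and the
   position of the robber when he is visible. *)
Definition view (n : nat) : Type := (cops n * option V)%type.

Definition see (vis : visibility) (n : nat) (C : cops n) (r : V) : view n :=
  (C, if vis n C r then Some r else None).

(* The cops choose their next positions from all their past views, in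
   chronological order. *)
Record strategy (n : nat) : Type := Strategy {
  start_cops : cops n;
  next_cops : seq (view n) -> cops n
}.

Definition legal (n : nat) (s : strategy n) : Prop :=
  forall (h : seq (view n)) (v : view n) (i : 'I_n),
    step (v.1 i) (next_cops s (rcons h v) i).

(* Here r t is the position of the robber after t moves, r 0 being the vertex
   he starts from. *)
Definition robber_play (r : nat -> V) : Prop :=
  forall t : nat, step (r t) (r t.+1).

(* The views of the cops before their move in round t.+1. Each round adds two
   views, one after the move of the cops and one after that of the robber. *)
Fixpoint history (vis : visibility) (n : nat) (s : strategy n) (r : nat -> V)
    (t : nat) : seq (view n) :=
  if t is t'.+1 then
    let h := history vis s r t' in
    let C := next_cops s h in
    h ++ [:: see vis C (r t'); see vis C (r t)]
  else [:: see vis (start_cops s) (r 0)].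

Definition cops_at (vis : visibility) (n : nat) (s : strategy n) (r : nat -> V)
    (t : nat) : cops n :=
  if t is t'.+1 then next_cops s (history vis s r t') else start_cops s.

(* The robber may be caught on his own turn or on the turn of the cops. *)
Definition captured (vis : visibility) (n : nat) (s : strategy n)
    (r : nat -> V) : Prop :=
  exists (t : nat) (i : 'I_n),
    cops_at vis s r t i = r t \/ cops_at vis s r t.+1 i = r t.

(* Quantifying over all plays of the robber, for a fixed strategy of the cops,
   accounts for his omniscience. *)
Definition cops_win (vis : visibility) (n : nat) : Prop :=
  exists s : strategy n,
    legal s /\ forall r : nat -> V, robber_play r -> captured vis s r.

Lemma cops_win_exists (vis : visibility) : exists n, `[< cops_win vis n >].
Proof.
exists #|V|; apply/asboolP.
pose C : cops #|V| := [ffun i => enum_val i].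
exists (Strategy C (fun h => (last (C, None) h).1)); split.
  by move=> h v i; rewrite /step /= last_rcons eqxx.
by move=> r _; exists 0, (enum_rank (r 0)); left; rewrite /= ffunE enum_rankK.
Qed.

Definition min_cops (vis : visibility) : nat := ex_minn (cops_win_exists vis).

Definition cop_number : nat := min_cops always_visible.

Definition hyperopic_cop_number (k : nat) : nat :=
  min_cops (hyperopic_visible k).

Definition zero_visibility_cop_number : nat := min_cops zero_visible.

End Game.

(* Main.v *)
Require Import Defs.
From mathcomp Require Import all_boot.
From mathcomp Require Import boolp.

(** The four games differ only in when the robber is seen: he is seen in the
    0-visibility game only if he is seen in the hyperopic game with parameter l,
    which happens only if he is seen in the one with parameter k, and in the
    usual game he is always seen. Cops who see more can discard the surplus:
    from each view they can compute the view they would have had under the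
    poorer rule ([coarsen]), so they can follow any strategy made for that rule
    and occupy the same vertices against the same play of the robber
    ([cops_at_coarsen_strategy]). Hence a number of cops that wins under the
    poorer rule wins under the richer one, and the least winning numbers compare
    accordingly ([leq_min_cops]). *)

Section VisibilityComparison.

Context {V : finType} {e : rel V}.
Implicit Types (vis : visibility V) (r : nat -> V).

(** This depends on the view alone: an unseen robber stays unseen, and for a
    seen one the view holds all that the rule [vis] needs. *)
Definition coarsen vis n (v : view V n) : view V n :=
  (v.1, if v.2 is Some x then if vis n v.1 x then Some x else None else None).

Definition coarsen_strategy vis n (s : strategy V n) : strategy V n :=
  Strategy (start_cops s) (fun h => next_cops s (map (coarsen vis n) h)).

Lemma legal_coarsen_strategy vis n (s : strategy V n) :
  legal e s -> legal e (coarsen_strategy vis n s).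
Proof.
move=> s_legal h v i; rewrite /= map_rcons.
exact: (s_legal _ (coarsen vis n v)).
Qed.

Section Implied.

Context {poor rich : visibility V}.
Hypothesis poor_rich : forall n (C : cops V n) x, poor n C x -> rich n C x.

Lemma coarsen_see n (C : cops V n) x :
  coarsen poor n (see rich C x) = see poor C x.
Proof.
rewrite /coarsen /see /=; case seen: (poor n C x); first by rewrite poor_rich ?seen.
by case: ifP; rewrite ?seen.
Qed.

Lemma history_coarsen_strategy n (s : strategy V n) r t :
  map (coarsen poor n) (history rich (coarsen_strategy poor n s) r t)
    = history poor s r t.
Proof.
by elim: t => [|t IHt]; rewrite /= ?map_cat /= !coarsen_see ?IHt.
Qed.

Lemma cops_at_coarsen_strategy n (s : strategy V n) r t :
  cops_at rich (coarsen_strategy poor n s) r t = cops_at poor s r t.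
Proof. by case: t => [|t] //=; rewrite history_coarsen_strategy. Qed.

Lemma cops_win_implied n : cops_win e poor n -> cops_win e rich n.
Proof.
case=> s [s_legal s_wins]; exists (coarsen_strategy poor n s).
split=> [|r r_play]; first exact: legal_coarsen_strategy.
have [t [i caught]] := s_wins r r_play.
by exists t, i; rewrite !cops_at_coarsen_strategy.
Qed.

Lemma leq_min_cops : min_cops e rich <= min_cops e poor.
Proof.
rewrite /min_cops; case: ex_minnP => m _ m_min; case: ex_minnP => p p_wins _.
by apply/m_min/asboolP/cops_win_implied/asboolP.
Qed.

End Implied.

Lemma distxx (x : V) : dist e x x = 0.
Proof.
rewrite /dist; have: 0 < #|V| by apply/card_gt0P; exists x.
case: #|V| => //= m _.
suff -> : has_walk e x x 0 by [].
by apply/existsP; exists [tuple]; rewrite /= eqxx.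
Qed.

Lemma zero_visible_hyperopic k n (C : cops V n) x :
  zero_visible C x -> hyperopic_visible e k C x.
Proof.
by case/existsP=> i /eqP Ci; rewrite /hyperopic_visible negb_forall;
  apply/existsP; exists i; rewrite Ci distxx.
Qed.

Lemma hyperopic_visible_leq k l n (C : cops V n) x :
  k <= l -> hyperopic_visible e l C x -> hyperopic_visible e k C x.
Proof.
move=> le_kl; apply: contra => /forallP near; apply/forallP => i.
by have /andP[-> /leq_trans->] := near i.
Qed.

End VisibilityComparison.

Theorem mainTheorem9 (V : finType) (e : rel V) (e_simple : simple_graph e)
    (e_connected : connected_graph e) (k l : nat) (k_ge1 : 1 <= k)
    (le_kl : k <= l) :
  [/\ cop_number e <= hyperopic_cop_number e k,
      hyperopic_cop_number e k <= hyperopic_cop_number e l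
    & hyperopic_cop_number e l <= zero_visibility_cop_number e].
Proof.
split; apply: leq_min_cops => // n C x.
- exact: hyperopic_visible_leq.
- exact: zero_visible_hyperopic.
Qed.
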